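(* Let $w$ be a multilinear commutator word and let $G$ be a profinite group having countably many soluble (closed) subgroups $G_1, G_2, \ldots$ whose union contains all $w$-values in $G$. Then the verbal subgroup $w(G)$ is soluble-by-finite.
   Context: A multilinear commutator word (also called an outer commutator word) is a group-word having the form of a multilinear Lie monomial, i.e. it is constructed by nesting commutators using always different indeterminates (for example $[[x_1,x_2],[y_1,y_2,y_5],z]$ is a multilinear commutator, while $[x,y,y,y]$ is not; a single indeterminate $x_1$ counts as the trivial case). Here $[x_1,\ldots,x_k]=[[x_1,\ldots,x_{k-1}],x_k]$. A $w$-value in $G$ is an element $w(g_1,\ldots,g_n)$ with $g_1,\ldots,g_n\in G$. For profinite groups all usual group-theoretic concepts are interpreted topologically: subgroups are closed, and the verbal subgroup $w(G)$ is the closed subgroup of $G$ generated by all $w$-values in $G$. A group is soluble-by-finite if it has a soluble normal subgroup of finite index. *)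

(* Defs.v *)
From HB Require Import structures.
From mathcomp Require Import all_boot.
From mathcomp Require Import boolp classical_sets cardinality topology.

Set Implicit Arguments.
Unset Strict Implicit.
Unset Printing Implicit Defensive.

Local Open Scope classical_set_scope.
Local Open Scope group_scope.

HB.mixin Record isTopologicalGroup G & Topological G & Group G := {
  mulg_continuous : continuous (fun z : G * G => z.1 * z.2) ;
  invg_continuous : continuous (fun x : G => x^-1)
}.

#[short(type="topologicalGroupType")]
HB.structure Definition TopologicalGroup :=
  {G of Topological G & Group G & isTopologicalGroup G}.

Definition profinite (G : topologicalGroupType) : Prop :=
  [/\ compact [set: G], hausdorff_space G & totally_disconnected [set: G]].

(* Group-words are unreduced expressions in indeterminates indexed by nat. *)
Inductive group_word : Type :=
  | WVar of nat
  | WOne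
  | WMul of group_word & group_word
  | WInv of group_word.

Fixpoint word_vars (w : group_word) : seq nat :=
  match w with
  | WVar i => [:: i]
  | WOne => [::]
  | WMul u v => word_vars u ++ word_vars v
  | WInv u => word_vars u
  end.

Fixpoint word_eval (G : groupType) (g : nat -> G) (w : group_word) : G :=
  match w with
  | WVar i => g i
  | WOne => 1
  | WMul u v => word_eval g u * word_eval g v
  | WInv u => (word_eval g u)^-1
  end.

(* Same convention as MathComp: [~ x, y] = x^-1 y^-1 x y. *)
Definition WComm (u v : group_word) : group_word :=
  WMul (WInv u) (WMul (WInv v) (WMul u v)).

Lemma word_eval_comm (G : groupType) (g : nat -> G) (u v : group_word) :
  word_eval g (WComm u v) = [~ word_eval g u, word_eval g v].
Proof. by []. Qed.

(* Requiring disjoint variables at each bracket makes all the indeterminates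
   at the leaves of the commutator pairwise different. *)
Inductive multilinear_commutator : group_word -> Prop :=
  | mlc_var i : multilinear_commutator (WVar i)
  | mlc_comm u v :
      multilinear_commutator u -> multilinear_commutator v ->
      ~~ has (mem (word_vars u)) (word_vars v) ->
      multilinear_commutator (WComm u v).

(* Indeterminates not occurring in w receive values too, without effect. *)
Definition word_values (G : groupType) (w : group_word) : set G :=
  [set word_eval g w | g in [set: nat -> G]].
Arguments word_values : clear implicits.

Definition subgroup (G : groupType) (H : set G) : Prop :=
  [/\ H 1, forall x y, H x -> H y -> H (x * y) & forall x, H x -> H x^-1].

Definition closed_subgroup (G : topologicalGroupType) (H : set G) : Prop :=
  subgroup H /\ closed H.

Definition closed_gen (G : topologicalGroupType) (A : set G) : set G :=
  smallest (@closed_subgroup G) A.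

Definition verbal_subgroup (G : topologicalGroupType) (w : group_word) :
    set G :=
  closed_gen (word_values G w).
Arguments verbal_subgroup : clear implicits.

Definition closed_derived (G : topologicalGroupType) (H : set G) : set G :=
  closed_gen [set z | exists x y, [/\ H x, H y & z = [~ x, y]]].

Definition soluble (G : topologicalGroupType) (H : set G) : Prop :=
  exists n : nat, iter n (@closed_derived G) H = [set 1].

Definition normal_subgroup_of (G : groupType) (N H : set G) : Prop :=
  [/\ subgroup N, N `<=` H & forall x h, N x -> H h -> N (x ^ h)].

Definition finite_index_in (G : groupType) (N H : set G) : Prop :=
  finite_set [set [set x * n | n in N] | x in H].

Definition soluble_by_finite (G : topologicalGroupType) (H : set G) : Prop :=
  exists N : set G, [/\ closed N, normal_subgroup_of N H, soluble N
                      & finite_index_in N H].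

(* Main.v *)
Require Import Defs.
From HB Require Import structures.
From mathcomp Require Import all_boot.
From mathcomp Require Import boolp classical_sets cardinality topology.

(* By compactness (a Baire argument) there are an open normal subgroup M and
   cosets c_j M such that w maps the product of the c_j M into a single S_i.
   If S_i has derived length d, then the d-fold iterated commutators of values
   of w on the c_j M vanish.  For a multilinear commutator v, a coset identity
   v(c_1 M, ..., c_n M) = 1 implies v(M, ..., M) = 1, by expanding
   [x m, z] = [x, z]^m [m, z] one indeterminate at a time.  Hence the iterated
   commutators of values of w on M vanish too, and since these generate a
   subgroup containing some term of the derived series of M, the open subgroup
   M is soluble. *)

Local Open Scope classical_set_scope.

(** * Clopen neighbourhoods in compact totally disconnected spaces *)

Section CompactTotallyDisconnected.

Local Set Implicit Arguments.
Local Unset Strict Implicit.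

Variable T : topologicalType.
Hypothesis cptT : compact [set: T].

(** A cluster point of the filter generated by the [f i] lies in the closure of each of them. *)
Lemma compact_directed_bigcap (I : Type) (D : set I) (f : I -> set T) :
  D !=set0 -> (forall i, D i -> closed (f i) /\ f i !=set0) ->
  (forall i j, D i -> D j -> exists2 k, D k & f k `<=` f i `&` f j) ->
  \bigcap_(i in D) f i !=set0.
Proof.
move=> D0 fP fI.
have FF : Filter (filter_from D f) by exact: filter_from_filter.
have PF : ProperFilter (filter_from D f).
  by apply: filter_from_proper => // i /fP[].
have FT : filter_from D f [set: T] by have [i Di] := D0; exists i.
have [x [_ clx]] := cptT PF FT.
exists x => i Di; have [cli _] := fP i Di.
by apply: cli => B xB; apply: clx xB; exists i.
Qed.

(** Otherwise the closed sets [D \ U] are nonempty and directed, so by compactness they share a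
    point; it lies in every [D] but not in [U]. *)
Lemma clopen_sub_open (x : T) (U : set T) : open U ->
  \bigcap_(D in [set D | clopen D /\ D x]) D `<=` U ->
  exists D, [/\ clopen D, D x & D `<=` U].
Proof.
move=> oU capU; apply: contrapT => noD.
have [|D [cD Dx]|D E [cD Dx] [cE Ex]|y capy] :=
  @compact_directed_bigcap _ [set D | clopen D /\ D x] (fun D => D `&` ~` U).
- by exists setT; split=> //; exact: clopenT.
- split; first by apply: closedI; [exact: cD.2|exact: open_closedC].
  apply: contrapT => /nonemptyPn DU; apply: noD; exists D; split=> // y Dy.
  apply: contrapT => nUy.
  by have : (D `&` ~` U) y by []; rewrite DU.
- exists (D `&` E); first by split; [exact: clopenI|].
  by move=> y [[Dy Ey] nUy].
have Uy : U y by apply: capU => D /capy[].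
by have [_ /(_ Uy)] := capy setT (conj clopenT I).
Qed.

(** Let [B] be a nonempty relatively clopen part of [Q]. Normality separates [B] from the rest of
    [Q] by an open [U], whose trace on a suitable clopen [D] around [x] is clopen. A clopen set
    contains [Q] or misses it, and this one meets [Q] exactly in [B]. *)
Lemma quasi_component_connected (x : T) : hausdorff_space T ->
  connected (\bigcap_(D in [set D | clopen D /\ D x]) D).
Proof.
move=> hsT; set Q := (X in connected X).
have cQ : closed Q by apply: closed_bigI => D [[]].
move=> B [b Bb] [C oC BC] [E cE BE].
have clB : closed B by rewrite BE; exact: closedI.
have clQB : closed (Q `&` ~` C) by apply: closedI => //; exact: open_closedC.
have BQB : set_nbhs B (~` (Q `&` ~` C)).
  apply/set_nbhsP; exists (~` (Q `&` ~` C)); split=> //.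
    exact: closed_openC.
  by rewrite BC => y [Qy Cy] [_ /(_ Cy)].
have [V BV clV] := compact_normal hsT cptT clB BQB.
have [U [oU BU UV]] := (set_nbhsP _ _).1 BV.
have QUV : Q `<=` U `|` ~` closure V.
  move=> y Qy; have [Cy|nCy] := pselect (C y).
    by left; apply: BU; rewrite BC.
  by right => /clV; apply.
have [|D [[oD cD] Dx DUV]] := clopen_sub_open _ QUV.
  by apply: openU => //; apply: closed_openC; exact: closed_closure.
(* [D] has no point in [closure V] outside [U]; the first description of the trace is open, the
   second closed. *)
have DUE : D `&` U = D `&` closure V.
  apply/seteqP; split=> y [Dy]; first by move=> /UV /subset_closure.
  by move=> Vy; split=> //; have [] := DUV _ Dy.
have cDU : clopen (D `&` U).
  split; first exact: openI.
  by rewrite DUE; apply: closedI => //; exact: closed_closure.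
have [Ux|nUx] := pselect (U x).
  rewrite BC; apply/seteqP; split=> y; first by case.
  move=> Qy; split=> //; apply: contrapT => nCy.
  have [_ /UV Vy] : (D `&` U) y by exact: Qy.
  by apply: (clV y) => //; exact: subset_closure.
have [] : (~` (D `&` U)) b.
  have Qb : Q b by move: Bb; rewrite BC => -[].
  by apply: Qb; split; [exact: clopenC|case].
split; last exact: BU.
by move: Bb; rewrite BC => -[Qb _]; exact: Qb.
Qed.

(** The quasi-component of [x] is connected, hence [{x}], hence inside the interior of [U]. *)
Lemma totally_disconnected_clopen_nbhs (x : T) (U : set T) :
  hausdorff_space T -> totally_disconnected [set: T] -> nbhs x U ->
  exists D, [/\ clopen D, D x & D `<=` U].
Proof.
move=> hsT tdT xU.
have [|y Qy|D [cD Dx DU]] := @clopen_sub_open x U°.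
- exact: open_interior.
- have -> : y = x; last exact: nbhs_singleton (nbhs_interior xU).
  rewrite -[y = x]/([set x] y) -(tdT x I).
  apply: connected_component_max Qy => //.
    by move=> D [].
  exact: quasi_component_connected.
- by exists D; split=> //; exact: subset_trans DU (@interior_subset _ _).
Qed.

End CompactTotallyDisconnected.

(** * Cosets and commutators of subsets of a group *)

Section CommutatorSets.

Local Set Implicit Arguments.
Local Unset Strict Implicit.
Local Open Scope group_scope.

Variable G : groupType.
Implicit Types (x y m : G) (A B M : set G).

Definition left_coset x M : set G := [set x * m | m in M].

Lemma left_cosetP M x y : left_coset x M y <-> M (x^-1 * y).
Proof.
split=> [[m Mm <-]|Mxy]; first by rewrite mulgA mulVg mul1g.
by exists (x^-1 * y) => //; rewrite mulgA mulgV mul1g.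
Qed.

Lemma left_coset_eq M x y : subgroup M -> left_coset x M y ->
  left_coset x M = left_coset y M.
Proof.
move=> [_ MM MV] /left_cosetP Mxy; apply/seteqP; split=> z /left_cosetP Mz;
  apply/left_cosetP.
  by have := MM _ _ (MV _ Mxy) Mz; rewrite invgM invgK !mulgA mulgK.
by have := MM _ _ Mxy Mz; rewrite !mulgA mulgK.
Qed.

(** What remains of normality for sets of word values, which need not be subgroups; it absorbs the
    conjugations arising when commutators are expanded. *)
Definition conj_stable M A := forall a m, A a -> M m -> A (a ^ m).

(** By conversion, [closed_derived H] is [closed_gen (commutators H H)]. *)
Definition commutators A B : set G :=
  [set z | exists x y, [/\ A x, B y & z = [~ x, y]]].

Lemma commutators_sub A A' B B' :
  A `<=` A' -> B `<=` B' -> commutators A B `<=` commutators A' B'.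
Proof.
move=> AA' BB' _ [x [y [Ax By ->]]].
by exists x, y; split; [exact: AA'|exact: BB'|].
Qed.

Lemma conj_stable_commutators M A B :
  conj_stable M A -> conj_stable M B -> conj_stable M (commutators A B).
Proof.
move=> sA sB _ m [x [y [Ax By ->]]] Mm; exists (x ^ m), (y ^ m).
by split; [exact: sA|exact: sB|rewrite conjRg].
Qed.

Lemma conj_stable_iter_commutators M A n : conj_stable M A ->
  conj_stable M (iter n (fun X => commutators X X) A).
Proof. by move=> sA; elim: n => //= n IH; exact: conj_stable_commutators. Qed.

Lemma commMg x y z : [~ x * y, z] = [~ x, z] ^ y * [~ y, z].
Proof. by rewrite /commg /conjg !invgM !mulgA; rewrite !mulgK. Qed.

Lemma commVg x y : [~ x^-1, y] = ([~ x, y]^-1) ^ x^-1.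
Proof. by rewrite /commg /conjg !invgM !invgK !mulgA mulgK. Qed.

(** * From cosets of a normal subgroup to the subgroup itself *)

Section Linearization.

Variable M : set G.
Hypothesis nM : normal_subgroup_of M [set: G].

Let M1 : M 1. Proof. by case: nM => -[]. Qed.
Let MM x y : M x -> M y -> M (x * y).
Proof. by case: nM => -[_ + _] _ _; apply. Qed.
Let MV x : M x -> M x^-1. Proof. by case: nM => -[_ _ +] _ _; apply. Qed.
Let MJ x y : M x -> M (x ^ y). Proof. by case: nM => _ _ + Mx; apply. Qed.

Lemma normal_sub_commutatorsl A B : A `<=` M -> commutators A B `<=` M.
Proof.
move=> AM _ [x [y [/AM Mx _ ->]]].
by rewrite commgEl; apply: MM; [exact: MV|exact: MJ].
Qed.

Lemma normal_sub_commutatorsr A B : B `<=` M -> commutators A B `<=` M.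
Proof.
move=> BM _ [x [y [_ /BM My ->]]].
by rewrite commgEr; apply: MM => //; apply: MJ; exact: MV.
Qed.

Lemma conj_stable_left_coset x : conj_stable M (left_coset x M).
Proof.
(* The witness comes from [(x n)^m = x ((m^-1)^x n m)]. *)
move=> _ m [n Mn <-] Mm; exists ((m^-1) ^ x * n * m).
  by apply: MM => //; apply: MM => //; apply: MJ; exact: MV.
by rewrite /conjg !mulgA mulgV mul1g.
Qed.

Lemma conj_stable_normal : conj_stable M M.
Proof. by move=> a m Ma _; exact: MJ. Qed.

(* Semantic form of [w(.., x m, ..) = w(.., x', ..) * w(.., m, ..)] with [m] in
   [M] and [x'] in [x M]: [A] and [A'] are the sets of values of [w] before and
   after replacing the coset [x M] by [M] in one argument. *)
Definition linear_step A A' :=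
  [/\ conj_stable M A, A' `<=` M &
      forall y, A' y -> exists2 x, A x & A (x * y)].

(** Finite chains of linear steps; for word values there is one step per indeterminate. *)
Inductive linearizes : set G -> set G -> Prop :=
  | linearizes_refl A : linearizes A A
  | linearizes_step A A' A'' :
      linear_step A A' -> linearizes A' A'' -> linearizes A A''.

Lemma linearizes_trans A A' A'' :
  linearizes A A' -> linearizes A' A'' -> linearizes A A''.
Proof.
elim=> // {}A {}A' B AA' _ IH /IH; exact: linearizes_step.
Qed.

(** In each step [x] and [x y] both lie in a trivial set, so [y = 1]. *)
Lemma linearizes_sub1 A A' :
  linearizes A A' -> A `<=` [set 1] -> A' `<=` [set 1].
Proof.
elim=> // {}A {}A' B [_ _ AA'] _ IH A1; apply: IH => y /AA'[x /A1 -> /A1].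
by rewrite mul1g.
Qed.

Lemma linear_step_left_coset x : linear_step (left_coset x M) M.
Proof.
split=> // [|y My]; first exact: conj_stable_left_coset.
by exists x; [exists 1; rewrite ?mulg1|exists y].
Qed.

(** In [[x y, b] = [x, b]^y [y, b]] the conjugating [y] lies in [M], so the first factor is again a
    commutator of the same kind. *)
Lemma linear_step_commutatorsl A A' B : conj_stable M B ->
  linear_step A A' -> linear_step (commutators A B) (commutators A' B).
Proof.
move=> sB [sA A'M AA']; have sAB := conj_stable_commutators sA sB.
split=> //; first exact: normal_sub_commutatorsl.
move=> _ [y [b [A'y Bb ->]]]; have [x Ax Axy] := AA' y A'y.
exists ([~ x, b] ^ y); last by rewrite -commMg; exists (x * y), b.
by apply: sAB; [exists x, b|exact: A'M].
Qed.

Lemma linear_step_commutatorsr A A' B : conj_stable M B ->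
  linear_step A A' -> linear_step (commutators B A) (commutators B A').
Proof.
move=> sB [sA A'M AA']; have sBA := conj_stable_commutators sB sA.
have BA'M : commutators B A' `<=` M by exact: normal_sub_commutatorsr.
split=> // _ [b [y [Bb A'y ->]]]; have [x Ax Axy] := AA' y A'y.
(* Here [[b, x y] = [b, y] [b, x]^y]; moving [[b, y]] to the right conjugates the other factor by
   its inverse. *)
exists ([~ b, x] ^ (y * [~ b, y]^-1)).
  apply: sBA; first by exists b, x.
  by apply: MM; [exact: A'M|apply: MV; apply: BA'M; exists b, y].
exists b, (x * y); split=> //.
by rewrite /commg /conjg !invgM !invgK !mulgA !(mulgK, mulgVK).
Qed.

(** The left argument is linearized first, against the fixed [B], then the right one against the
    fixed [A']. *)
Lemma linearizes_commutators A A' B B' :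
  conj_stable M A' -> conj_stable M B ->
  linearizes A A' -> linearizes B B' ->
  linearizes (commutators A B) (commutators A' B').
Proof.
move=> sA' sB AA' BB'; apply: (@linearizes_trans _ (commutators A' B)).
  elim: AA' => [C|C D E CD _]; first exact: linearizes_refl.
  by apply: linearizes_step; exact: linear_step_commutatorsl.
elim: BB' => [C|C D E CD _]; first exact: linearizes_refl.
by apply: linearizes_step; exact: linear_step_commutatorsr.
Qed.

Lemma linearizes_iter_commutators A A' n :
  conj_stable M A -> conj_stable M A' -> linearizes A A' ->
  linearizes (iter n (fun X => commutators X X) A)
             (iter n (fun X => commutators X X) A').
Proof.
move=> sA sA' AA'; elim: n => //= n IH.
by apply: linearizes_commutators => //; exact: conj_stable_iter_commutators.
Qed.

End Linearization.

(** * Word values with each indeterminate confined to a prescribed set *)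

Definition word_values_in (C : nat -> set G) (w : group_word) : set G :=
  [set word_eval f w | f in [set f | forall j, C j (f j)]].

Lemma eq_in_word_eval (w : group_word) (f g : nat -> G) :
  {in word_vars w, f =1 g} -> word_eval f w = word_eval g w.
Proof.
elim: w => //= [i|u IHu v IHv|u IHu] fg.
- by apply: fg; rewrite inE.
- by rewrite IHu ?IHv // => i iw; apply: fg; rewrite mem_cat iw ?orbT.
- by rewrite IHu.
Qed.

Lemma word_evalJ (w : group_word) (f : nat -> G) x :
  word_eval (fun j => f j ^ x) w = word_eval f w ^ x.
Proof.
elim: w => //= [|u -> v ->|u ->].
- by rewrite conj1g.
- by rewrite conjMg.
- by rewrite conjVg.
Qed.

Lemma conj_stable_word_values_in M (C : nat -> set G) w :
  (forall j, conj_stable M (C j)) -> conj_stable M (word_values_in C w).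
Proof.
move=> sC _ m [f Cf <-] Mm; exists (fun j => f j ^ m); last exact: word_evalJ.
by move=> j; exact: sC.
Qed.

(** Since [u] and [v] share no indeterminate, assignments chosen independently for them can be
    glued. *)
Lemma word_values_in_comm (C : nat -> set G) u v :
  ~~ has (mem (word_vars u)) (word_vars v) ->
  word_values_in C (WComm u v) =
  commutators (word_values_in C u) (word_values_in C v).
Proof.
move=> uv; apply/seteqP; split=> z.
  move=> [f Cf <-]; exists (word_eval f u), (word_eval f v).
  by split=> //; exists f.
move=> [_ [_ [[f Cf <-] [g Cg <-] ->]]].
exists (fun j => if j \in word_vars u then f j else g j).
  by move=> j /=; case: ifP.
rewrite word_eval_comm; congr [~ _, _]; apply: eq_in_word_eval => j.
  by move=> ->.
by move=> jv; case: ifP => // ju; case/hasP: uv; exists j.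
Qed.

(** Induction on the nesting: an indeterminate is one linear step, and a bracket combines the chains
    of its two sides. *)
Lemma linearizes_word_values M (g : nat -> G) w :
  normal_subgroup_of M [set: G] -> multilinear_commutator w ->
  linearizes M (word_values_in (fun j => left_coset (g j) M) w)
               (word_values_in (fun=> M) w).
Proof.
move=> nM; elim=> {w} [i|u v _ IHu _ IHv uv].
  (* Nonemptiness of every [C j] lets one chosen value be extended to a full assignment. *)
  have word_values_in_var (C : nat -> set G) :
      (forall j, C j !=set0) -> word_values_in C (WVar i) = C i.
    move=> C0; apply/seteqP; split=> [_ [f Cf <-] //|x Cx].
    have [f Cf] := choice C0.
    exists (fun j => if j == i then x else f j); last by rewrite /= eqxx.
    by move=> j /=; case: eqVneq => [->|].
  have M1 : M 1 by case: nM => -[].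
  rewrite !word_values_in_var; first last.
  - by move=> j; exists (g j * 1), 1.
  - by move=> j; exists 1.
  apply: linearizes_step (linearizes_refl _ _).
  exact: linear_step_left_coset.
rewrite !word_values_in_comm //; apply: linearizes_commutators => //.
  by apply: conj_stable_word_values_in => j; exact: conj_stable_normal.
by apply: conj_stable_word_values_in => j; exact: conj_stable_left_coset.
Qed.

End CommutatorSets.

(** * Closed subgroups and derived series of topological groups *)

Section TopologicalGroups.

Local Set Implicit Arguments.
Local Unset Strict Implicit.
Local Open Scope group_scope.

Variable G : topologicalGroupType.
Implicit Types (x y m : G) (A B H M N : set G).

Lemma cvg_mulg (I : Type) (F : set_system I) {FF : Filter F}
    (f g : I -> G) a b :
  f i @[i --> F] --> a -> g i @[i --> F] --> b ->
  f i * g i @[i --> F] --> a * b.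
Proof.
move=> fa gb.
exact: (cvg_comp (fun i => (f i, g i)) (fun z => z.1 * z.2)
  (cvg_pair fa gb) (mulg_continuous (a, b))).
Qed.

Lemma cvg_invg (I : Type) (F : set_system I) {FF : Filter F} (f : I -> G) a :
  f i @[i --> F] --> a -> (f i)^-1 @[i --> F] --> a^-1.
Proof. by move=> fa; exact: (cvg_comp f _ fa (invg_continuous a)). Qed.

Lemma continuous_mulgl x : continuous (fun y : G => x * y).
Proof. by move=> y; apply: cvg_mulg; [exact: cvg_cst|exact: cvg_id]. Qed.

Lemma continuous_conjg m : continuous (fun x : G => x ^ m).
Proof.
move=> x; apply: cvg_mulg; first exact: cvg_cst.
by apply: cvg_mulg; [exact: cvg_id|exact: cvg_cst].
Qed.

Lemma continuous_commgl y : continuous (fun x : G => [~ x, y]).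
Proof.
move=> x; apply: cvg_mulg; first by apply: cvg_invg; exact: cvg_id.
exact: continuous_conjg.
Qed.

Lemma closed_preimage (f : G -> G) A : continuous f -> closed A ->
  closed [set x | A (f x)].
Proof. by move=> cf cA; apply: preimage_closed => // x _; exact: cf. Qed.

Lemma closed_gen_closed_subgroup A : closed_subgroup (closed_gen A).
Proof.
split; first split.
- by move=> H [[[]]].
- move=> x y Ax Ay H HA; have [[[_ HM _] _] _] := HA.
  by apply: HM; [exact: Ax|exact: Ay].
- by move=> x Ax H HA; have [[[_ _ HV] _] _] := HA; apply: HV; exact: Ax.
by apply: closed_bigI => H [[]].
Qed.

Lemma sub_closed_gen A : A `<=` closed_gen A.
Proof. exact: sub_gen_smallest. Qed.

Lemma closed_gen_sub A H : closed_subgroup H -> A `<=` H -> closed_gen A `<=` H.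
Proof. exact: smallest_sub. Qed.

Lemma closed_derived_mono A B :
  A `<=` B -> closed_derived A `<=` closed_derived B.
Proof.
move=> AB; apply: closed_gen_sub; first exact: closed_gen_closed_subgroup.
apply: subset_trans (@sub_closed_gen _); exact: commutators_sub.
Qed.

Lemma iter_closed_derived_mono n A B : A `<=` B ->
  iter n (@closed_derived G) A `<=` iter n (@closed_derived G) B.
Proof. by move=> AB; elim: n => //= n; exact: closed_derived_mono. Qed.

Lemma closed_subgroup_iter_derived n H : closed_subgroup H ->
  closed_subgroup (iter n (@closed_derived G) H).
Proof. by case: n => //= n _; exact: closed_gen_closed_subgroup. Qed.

Lemma closed_derived_sub H : closed_subgroup H -> closed_derived H `<=` H.
Proof.
move=> cH; apply: closed_gen_sub => // _ [x [y [Hx Hy ->]]].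
have [[_ HM HV] _] := cH.
by apply: (HM) => //; [exact: HV|apply: (HM) => //; [exact: HV|exact: HM]].
Qed.

Lemma iter_closed_derived_antimono (m n : nat) H :
  closed_subgroup H -> (m <= n)%N ->
  iter n (@closed_derived G) H `<=` iter m (@closed_derived G) H.
Proof.
move=> cH /subnK <-; elim: (n - m)%N => //= k IH.
apply: subset_trans IH; apply: closed_derived_sub.
exact: closed_subgroup_iter_derived.
Qed.

Lemma iter_commutators_sub_derived n A H : A `<=` H ->
  iter n (fun X => commutators X X) A `<=` iter n (@closed_derived G) H.
Proof.
move=> AH; elim: n => //= n IH; apply: subset_trans (@sub_closed_gen _).
exact: commutators_sub.
Qed.

(** Conjugation is a continuous endomorphism, so the preimage of [closed_gen A] is a closed
    subgroup, and it contains [A]. *)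
Lemma conj_stable_closed_gen M A :
  conj_stable M A -> conj_stable M (closed_gen A).
Proof.
move=> sA a m Aa Mm.
have [[T1 TM TV] cT] := closed_gen_closed_subgroup A.
suff : closed_gen A `<=` [set x | closed_gen A (x ^ m)] by apply.
apply: closed_gen_sub => [|x Ax]; last by apply: sub_closed_gen; exact: sA.
split; last by apply: closed_preimage => //; exact: continuous_conjg.
split=> [|x y /= Tx Ty|x /= Tx]; first by rewrite /= conj1g.
  by rewrite conjMg; exact: TM.
by rewrite conjVg; exact: TV.
Qed.

(** For fixed [d], the [x] in [M] with [[x, d]] in [T] form a closed subgroup, by the expansion of
    [[x y, d]] and the stability of [T]. *)
Lemma commutators_closed_gen_sub M A B T :
  closed_subgroup M -> A `<=` M -> B `<=` M ->
  closed_subgroup T -> conj_stable M T ->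
  commutators A B `<=` T -> commutators (closed_gen A) (closed_gen B) `<=` T.
Proof.
move=> cM; have [[M1 MM MV] clM] := cM => AM BM [[T1 TM TV] clT] sT.
have half C D : C `<=` M -> commutators C D `<=` T ->
    commutators (closed_gen C) D `<=` T.
  move=> CM CDT _ [x [d [Cx Dd ->]]]; move: x Cx.
  suff : closed_gen C `<=` M `&` [set x | T [~ x, d]].
    by move=> + x => /[apply] -[].
  apply: closed_gen_sub => [|x Cx]; last first.
    by split; [exact: CM|apply: CDT; exists x, d].
  split; last first.
    apply: closedI => //; apply: closed_preimage => //.
    exact: continuous_commgl.
  split=> [|x y [Mx Tx] [My Ty]|x [Mx Tx]].
  - by split=> //=; rewrite comm1g.
  - by split=> /=; [exact: MM|rewrite commMg; apply: TM => //; exact: sT].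
  - split=> /=; first exact: MV.
    by rewrite commVg; apply: sT; [exact: TV|exact: MV].
have swap C D : commutators C D `<=` T -> commutators D C `<=` T.
  move=> CDT _ [x [y [Dx Cy ->]]]; rewrite -invgR; apply: TV.
  by apply: CDT; exists y, x.
(* From the inside out: swap, pass to [closed_gen B], swap back, pass to [closed_gen A]. *)
by move=> ABT; exact: half AM (swap _ _ (half _ _ BM (swap _ _ ABT))).
Qed.

(** The term of index [maxn m n] lies in both [closed_gen A] and [closed_gen B]; one more derivation
    takes commutators between these two. *)
Lemma derived_sub_gen_commutators M A B (m n : nat) :
  closed_subgroup M -> A `<=` M -> B `<=` M ->
  conj_stable M A -> conj_stable M B ->
  iter m (@closed_derived G) M `<=` closed_gen A ->
  iter n (@closed_derived G) M `<=` closed_gen B ->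
  iter (maxn m n).+1 (@closed_derived G) M `<=` closed_gen (commutators A B).
Proof.
move=> cM AM BM sA sB mA nB.
apply: closed_gen_sub; first exact: closed_gen_closed_subgroup.
apply: (@subset_trans _ (commutators (closed_gen A) (closed_gen B))).
  apply: commutators_sub.
    apply: subset_trans mA; apply: iter_closed_derived_antimono => //.
    exact: leq_maxl.
  apply: subset_trans nB; apply: iter_closed_derived_antimono => //.
  exact: leq_maxr.
apply: (commutators_closed_gen_sub cM) => //.
- exact: closed_gen_closed_subgroup.
- by apply: conj_stable_closed_gen; exact: conj_stable_commutators.
- exact: sub_closed_gen.
Qed.

Lemma derived_sub_gen_iter_commutators M A (m d : nat) :
  closed_subgroup M -> normal_subgroup_of M [set: G] ->
  A `<=` M -> conj_stable M A ->
  iter m (@closed_derived G) M `<=` closed_gen A ->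
  exists n, iter n (@closed_derived G) M `<=`
            closed_gen (iter d (fun X => commutators X X) A).
Proof.
move=> cM nM AM sA mA.
suff [] : iter d (fun X => commutators X X) A `<=` M /\ exists n,
  iter n (@closed_derived G) M `<=`
  closed_gen (iter d (fun X => commutators X X) A) by [].
elim: d => [|d [IHM [n IH]]] /=; first by split=> //; exists m.
split; first exact: normal_sub_commutatorsl.
exists (maxn n n).+1; apply: derived_sub_gen_commutators => //.
  exact: conj_stable_iter_commutators.
exact: conj_stable_iter_commutators.
Qed.

(** Induction on [w]; the index [n] obtained is the nesting depth of the brackets. *)
Lemma derived_sub_gen_word_values M w :
  closed_subgroup M -> normal_subgroup_of M [set: G] ->
  multilinear_commutator w ->
  word_values_in (fun=> M) w `<=` M /\
  exists n, iter n (@closed_derived G) M `<=`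
            closed_gen (word_values_in (fun=> M) w).
Proof.
move=> cM nM; elim=> {w} [i|u v _ [uM [m IHu]] _ [vM [n IHv]] uv].
  split; first by move=> _ [f Mf <-]; exact: Mf.
  by exists 0 => x Mx; apply: sub_closed_gen; exists (fun=> x).
rewrite word_values_in_comm //; split; first exact: normal_sub_commutatorsl.
have sM w' : conj_stable M (word_values_in (fun=> M) w').
  by apply: conj_stable_word_values_in => _; exact: conj_stable_normal.
by exists (maxn m n).+1; exact: derived_sub_gen_commutators.
Qed.

(** The [d]-fold commutators of coset values lie in the trivial [d]-th derived term of [H].
    Linearization makes those of values on [M] trivial too, and they generate a closed subgroup
    containing a derived term of [M]. *)
Lemma soluble_of_coset_values M (c : nat -> G) w H :
  hausdorff_space G ->
  closed_subgroup M -> normal_subgroup_of M [set: G] ->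
  multilinear_commutator w -> soluble H ->
  word_values_in (fun j => left_coset (c j) M) w `<=` H -> soluble M.
Proof.
move=> hG cM nM hw [d Hd] cH.
have [VM [m mV]] := derived_sub_gen_word_values cM nM hw.
set V := word_values_in (fun=> M) w in VM mV.
have sV : conj_stable M V.
  by apply: conj_stable_word_values_in => _; exact: conj_stable_normal.
have sC : conj_stable M (word_values_in (fun j => left_coset (c j) M) w).
  by apply: conj_stable_word_values_in => j; exact: conj_stable_left_coset.
have Vd : iter d (fun X => commutators X X) V `<=` [set 1].
  have lin := linearizes_word_values c nM hw.
  have lind := linearizes_iter_commutators nM d sC sV lin.
  have := linearizes_sub1 lind; apply.
  by rewrite -Hd; exact: iter_commutators_sub_derived.
have [n nV] := derived_sub_gen_iter_commutators d cM nM VM sV mV.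
have [[iM1 _ _] _] := closed_subgroup_iter_derived n cM.
exists n; apply/seteqP; split=> [|_ -> //]; apply: (subset_trans nV).
apply: closed_gen_sub => //; split; last first.
  by apply: accessible_closed_set1; exact: hausdorff_accessible.
by split=> // [_ _ -> ->|_ ->] /=; rewrite ?mulg1 ?invg1.
Qed.

Lemma soluble_sub N M : subgroup N -> closed N -> N `<=` M -> soluble M ->
  soluble N.
Proof.
move=> sN cN NM [n nM]; exists n; apply/seteqP; split.
  by rewrite -nM; exact: iter_closed_derived_mono.
have [[N1 _ _] _] := closed_subgroup_iter_derived n (conj sN cN).
by move=> _ ->.
Qed.

End TopologicalGroups.

(** * Open normal subgroups of profinite groups and the Baire argument *)

Section ProfiniteGroups.

Local Set Implicit Arguments.
Local Unset Strict Implicit.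
Local Open Scope group_scope.

Variable G : topologicalGroupType.
Hypothesis profG : profinite G.
Implicit Types (x y : G) (M N H U : set G).

Let cptG : compact [set: G]. Proof. by case: profG. Qed.
Let hsG : hausdorff_space G. Proof. by case: profG. Qed.

(** A subgroup that is a neighbourhood of [1] is open, by translation. *)
Definition open_normal N := normal_subgroup_of N [set: G] /\ nbhs 1 N.

Lemma nbhs_translate x y U : nbhs (x * y) U -> nbhs y [set z | U (x * z)].
Proof. exact: (@continuous_mulgl G x y U). Qed.

Lemma clopen_locally_constant (I : Type) (F : set_system I) {FF : Filter F}
  (f : I -> G) x U : clopen U -> f i @[i --> F] --> x ->
  \forall i \near F, U (f i) <-> U x.
Proof.
move=> [oU cU] fx; have [Ux|nUx] := pselect (U x).
  have : nbhs x U by exact: open_nbhs_nbhs.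
  by move=> /fx FU; apply: (@filterS _ F FF (f @^-1` U)) FU => i Ufi; split.
have : nbhs x (~` U) by apply: open_nbhs_nbhs; split=> //; exact: closed_openC.
by move=> /fx FU; apply: (@filterS _ F FF (f @^-1` (~` U))) FU => i Ufi; split.
Qed.

(* The subgroup of those [x] whose insertion anywhere in a product does not
   affect membership in a given clopen set is normal, and it is open by
   compactness of [G * G]. *)
Lemma open_normal_base U : nbhs 1 U -> exists2 N, open_normal N & N `<=` U.
Proof.
move=> U1; have [_ _ tdG] := profG.
have [D [cD D1 DU]] := totally_disconnected_clopen_nbhs cptG hsG tdG U1.
exists [set x | forall a b, D (a * x * b) <-> D (a * b)]; last first.
  by move=> x /(_ 1 1); rewrite !mulg1 mul1g => Dx; apply: DU; apply/Dx.
split; first split=> //.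
- split=> [a b|x y Dx Dy a b|x Dx a b]; first by rewrite mulg1.
    by rewrite mulgA -(mulgA _ y) -Dy; have := Dx a (y * b); rewrite !mulgA.
  by rewrite -(Dx _ b) mulgVK.
- move=> x h Dx _ a b; have := Dx (a * h^-1) (h * b).
  by rewrite /conjg !mulgA mulgVK.
have cptGG : compact [set: G * G] by rewrite -setXTT; exact: compact_setX.
(* Near [((a, b), 1)] both memberships are constant, and they agree there because [a 1 b = a b]. *)
have cov p : [set: G * G] p -> \forall p' \near p & x \near nbhs (1 : G),
    D (p'.1 * x * p'.2) <-> D (p'.1 * p'.2).
  case: p => a b _.
  have fst_cvg : p.1.1 @[p --> ((a, b), 1 : G)] --> a.
    by apply: (@cvg_comp _ _ _ fst fst _ (nbhs (a, b))); exact: cvg_fst.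
  have snd_cvg : p.1.2 @[p --> ((a, b), 1 : G)] --> b.
    apply: (@cvg_comp _ _ _ fst snd _ (nbhs (a, b))); last exact: cvg_snd.
    exact: cvg_fst.
  have D3 : \forall p \near ((a, b), 1 : G),
      D (p.1.1 * p.2 * p.1.2) <-> D (a * 1 * b).
    exact: (clopen_locally_constant cD
      (cvg_mulg (cvg_mulg fst_cvg cvg_snd) snd_cvg)).
  have D2 : \forall p \near ((a, b), 1 : G), D (p.1.1 * p.1.2) <-> D (a * b).
    exact: (clopen_locally_constant cD (cvg_mulg fst_cvg snd_cvg)).
  apply: filterS2 D3 D2 => -[p x] /=.
  by rewrite mulg1 => -> ->.
have := (compact_near_coveringP _).1 cptGG _ _
  (fun x p => D (p.1 * x * p.2) <-> D (p.1 * p.2)) (nbhs_filter (1 : G)) cov.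
by apply: filterS => x Dx a b; exact: (Dx (a, b) I).
Qed.

Lemma open_normalI M N :
  open_normal M -> open_normal N -> open_normal (M `&` N).
Proof.
move=> [[[M1 MM MV] _ MJ] nM] [[[N1 NM NV] _ NJ] nN].
split; last exact: filterI.
split=> // [|x h [Mx Nx] _]; last by split; [exact: MJ|exact: NJ].
split=> // [x y [Mx Nx] [My Ny]|x [Mx Nx]].
  by split; [exact: MM|exact: NM].
by split; [exact: MV|exact: NV].
Qed.

Lemma open_left_coset M x : open_normal M -> open (left_coset x M).
Proof.
move=> [[sM _ _] M1]; rewrite openE => y xy.
rewrite (left_coset_eq sM xy) /interior /=.
have : nbhs (y^-1 * y) M by rewrite mulVg.
by move=> /nbhs_translate; apply: filterS => z /= ?; apply/left_cosetP.
Qed.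

(** The open coset of a point in the closure meets [x M], hence equals it. *)
Lemma closed_left_coset M x : open_normal M -> closed (left_coset x M).
Proof.
move=> oM; have [[sM _ _] _] := oM; move=> y cly.
have M1 : M 1 by case: sM.
have [|z [xz yz]] := cly (left_coset y M).
  apply: open_nbhs_nbhs; split; first exact: open_left_coset.
  by exists 1; rewrite ?mulg1.
rewrite (left_coset_eq sM xz) -(left_coset_eq sM yz).
by exists 1; rewrite ?mulg1.
Qed.

Lemma open_normal_closed_subgroup M : open_normal M -> closed_subgroup M.
Proof.
move=> oM; have [[sM _ _] _] := oM; split=> //.
suff -> : M = left_coset 1 M by exact: closed_left_coset.
by apply/seteqP; split=> x; rewrite left_cosetP invg1 mul1g.
Qed.

(** Otherwise the complements of finite unions of cosets have a common point, which would lie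
    outside its own coset. *)
Lemma finite_left_coset_cover M : open_normal M ->
  exists2 A, finite_set A & [set: G] `<=` \bigcup_(a in A) left_coset a M.
Proof.
move=> oM; apply: contrapT => noA.
have [|A fA|A B fA fB|x xA] := compact_directed_bigcap cptG
    (D := [set A : set G | finite_set A])
    (f := fun A => ~` \bigcup_(a in A) left_coset a M).
- by exists set0; exact: finite_set0.
- split.
    by apply: open_closedC; apply: bigcup_open => a _; exact: open_left_coset.
  apply: contrapT => /nonemptyPn nA; apply: noA; exists A => // x _.
  by apply: contrapT => nx; suff : set0 x by []; rewrite -nA.
- exists (A `|` B); first by rewrite /= finite_setU.
  by move=> x nAB; split=> -[a aA xa]; apply: nAB; exists a => //; [left|right].
have [[[M1 _ _] _ _] _] := oM.
apply: (xA [set x]); first exact: finite_set1.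
by exists x => //; exists 1; rewrite ?mulg1.
Qed.

(** Each coset of the intersection in [H] is the trace on [H] of one of finitely many cosets of
    [M]. *)
Lemma open_normal_finite_index M H : open_normal M -> subgroup H ->
  finite_index_in (M `&` H) H.
Proof.
move=> oM [_ HM HV]; have [A fA AG] := finite_left_coset_cover oM.
have [[sM _ _] _] := oM.
apply: (sub_finite_set _ (finite_image (fun a => left_coset a M `&` H) fA)).
move=> _ [x Hx <-]; have [a Aa ax] := AG x I; exists a => //.
rewrite (left_coset_eq sM ax); apply/seteqP.
split=> [y [/left_cosetP xy Hy]|_ [m [Mm Hm] <-]].
  apply/left_cosetP; split=> //; apply: HM => //; exact: HV.
by split; [exists m|exact: HM].
Qed.

(** Continuity of [w] in all its arguments at once; intersecting at products lets a single [N] serve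
    every indeterminate. *)
Lemma continuous_word_eval w (f : nat -> G) U : nbhs (word_eval f w) U ->
  exists2 N, open_normal N &
    word_values_in (fun j => left_coset (f j) N) w `<=` U.
Proof.
elim: w U => /= [i|||].
- move=> U; rewrite -{1}(mulg1 (f i)) => /nbhs_translate /open_normal_base.
  move=> [N oN NU]; exists N => // _ [g /(_ i) [n /NU Un fg] <-].
  by rewrite /= -fg.
- move=> U /open_normal_base[N oN NU]; exists N => // _ [g _ <-].
  by apply: NU; case: oN => -[[]].
- move=> u IHu v IHv U /(mulg_continuous (_, _)).
  move=> [[A B] /= [/IHu[M oM MA] /IHv[N oN NB]] ABU].
  exists (M `&` N); first exact: open_normalI.
  move=> _ [g gC <-]; apply: (ABU (word_eval g u, word_eval g v)).
  split; [apply: MA|apply: NB]; exists g => // j.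
    by have [n [Mn _] <-] := gC j; exists n.
  by have [n [_ Nn] <-] := gC j; exists n.
- move=> u IHu U /invg_continuous /IHu[N oN NU]; exists N => // _ [g gC <-].
  by apply: (NU (word_eval g u)); exists g.
Qed.

(* Baire category for the tuples of values of the indeterminates, with nested
   products of cosets in place of nested open sets. *)
Lemma covered_word_values w (S : nat -> set G) :
  (forall i, closed (S i)) ->
  word_values G w `<=` \bigcup_(i in [set: nat]) S i ->
  exists i (c : nat -> G) N,
    open_normal N /\ word_values_in (fun j => left_coset (c j) N) w `<=` S i.
Proof.
move=> clS cov; apply: contrapT => noS.
pose box (p : (nat -> G) * set G) j := left_coset (p.1 j) p.2.
(* A state holds a stage counter, the centres of the cosets and their common subgroup; the step at
   stage [k] shrinks the box so that its values avoid [S k]. *)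
pose state := {p : nat * ((nat -> G) * set G) | open_normal p.2.2}.
pose next (s t : state) := [/\ (sval t).1 = (sval s).1.+1,
  forall j, box (sval t).2 j `<=` box (sval s).2 j &
  word_values_in (box (sval t).2) w `&` S (sval s).1 = set0].
have step (s : state) : {t | next s t}.
  apply: cid; case: s => -[k [c N]] /= oN.
  (* By assumption no box has all its values in [S k]; a value outside the closed [S k] stays
     outside on a smaller box. *)
  have [f fc fS] : exists2 f, (forall j, box (c, N) j (f j)) &
      ~ S k (word_eval f w).
    apply: contrapT => nof; apply: noS; exists k, c, N; split=> // _ [f fc <-].
    by apply: contrapT => fS; apply: nof; exists f.
  have [|N' oN' N'S] := @continuous_word_eval w f (~` S k).
    by apply: open_nbhs_nbhs; split=> //; exact: closed_openC.
  exists (exist _ (k.+1, (f, N `&` N')) (open_normalI oN oN')).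
  have [[sN _ _] _] := oN; split=> //= [j x [n [Nn _] <-]|].
    by rewrite /box /= (left_coset_eq sN (fc j)); exists n.
  rewrite -subset0 => _ [[g gC <-]]; apply: N'S; exists g => // j.
  by have [n [_ N'n] <-] := gC j; exists n.
have oT : open_normal [set: G] by split=> //; exact: filterT.
have [F [F0 FS]] := dependent_choice step
  (exist _ (0, (fun=> 1, [set: G])) oT : state).
have Fidx k : (sval (F k)).1 = k.
  by elim: k => [|k IH]; [rewrite F0|have [-> _ _] := FS k; rewrite IH].
have Fle j k l : (k <= l)%N -> box (sval (F l)).2 j `<=` box (sval (F k)).2 j.
  move=> /subnK <-; elim: (l - k)%N => //= i IH.
  by have [_ + _] := FS (i + k)%N; move=> /(_ j) /subset_trans; apply.
(* Compactness is used in each coordinate separately; choice then assembles an assignment lying in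
   all boxes, whose value avoids every [S i]. *)
have capF j : \bigcap_(k in [set: nat]) box (sval (F k)).2 j !=set0.
  apply: (compact_directed_bigcap cptG); first by exists 0.
  - move=> k _; have oN := svalP (F k); split; first exact: closed_left_coset.
    have [[[N1 _ _] _ _] _] := oN.
    by exists ((sval (F k)).2.1 j * 1), 1.
  - move=> k l _ _; exists (maxn k l) => // x xkl.
    by split; apply: Fle xkl; rewrite ?leq_maxl ?leq_maxr.
have [f fP] := choice capF.
have [|i _ Si] := cov (word_eval f w); first by exists f.
have [_ _] := FS i; rewrite Fidx -subset0; apply; split; last exact: Si.
by exists f => // j; exact: fP.
Qed.

End ProfiniteGroups.

Theorem theorem4p1 (w : group_word) (hw : multilinear_commutator w)
    (G : topologicalGroupType) (hG : profinite G)
    (S : nat -> set G)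
    (hS : forall i : nat, closed_subgroup (S i) /\ soluble (S i))
    (hcover : word_values G w `<=` \bigcup_(i in [set: nat]) S i) :
  soluble_by_finite (verbal_subgroup G w).
Proof.
have [_ hsG _] := hG.
have [i [c [M [oM MS]]]] := covered_word_values hG (fun i => (hS i).1.2) hcover.
have [nM _] := oM; have [[M1 MM MV] _ MJ] := nM.
have cM := open_normal_closed_subgroup oM.
have solM := soluble_of_coset_values hsG cM nM hw (hS i).2 MS.
have [sW clW] := closed_gen_closed_subgroup (word_values G w).
rewrite -/(verbal_subgroup G w) in sW clW.
have [W1 WM WV] := sW.
(* The required soluble normal subgroup is the trace on [w(G)] of the open soluble subgroup [M]. *)
have sN : subgroup (M `&` verbal_subgroup G w).
  split=> // [x y [Mx Wx] [My Wy]|x [Mx Wx]].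
    by split; [exact: MM|exact: WM].
  by split; [exact: MV|exact: WV].
have clN : closed (M `&` verbal_subgroup G w).
  by apply: closedI => //; exact: cM.2.
exists (M `&` verbal_subgroup G w); split=> //.
- split=> // x h [Mx Wx] Wh; split; first exact: MJ.
  by apply: (WM); [exact: WV|exact: WM].
- by apply: soluble_sub solM.
- exact: open_normal_finite_index.
Qed.
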